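(* In the antithesis translation, an $\mathfrak L$-group consists of an $\mathfrak I$-group $G$ equipped with an inequality relation $\neq$ such that $$x^{-1}\neq y^{-1}\ \vdash_{x,y:G}\ x\neq y,\qquad xu\neq xv\ \vdash_{x,u,v:G}\ u\neq v,\qquad xu\neq yu\ \vdash_{x,y,u:G}\ x\neq y.$$ The extra condition for $G$ to be strong is $$(xu\neq yv)\ \vdash_{x,y,u,v:G}\ (x\neq y)\vee(u\neq v),$$ which is equivalent to $\neq$ being an apartness. In particular: \begin{itemize} \item An $\mathfrak L$-group with affirmative equality is precisely an $\mathfrak I$-group. \item A strong $\mathfrak L$-group with refutative equality is precisely a group with apartness relation, i.e. an $\mathfrak I$-group with a tight apartness for which the group operations are strongly extensional. \item An arbitrary $\mathfrak L$-group is precisely an $\mathfrak I$-group with a (symmetric irreflexive) translation invariant inequality. \end{itemize}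
   Context: Intuitionistic ($\mathfrak I$-) side. We work in intuitionistic predicate logic over types. An $\mathfrak I$-set is a type with an equivalence relation $=$; functions and relations respect $=$; an $\mathfrak I$-group is a group in this sense. An inequality relation on an $\mathfrak I$-set is an irreflexive symmetric relation $\neq$ (respecting $=$); it is an apartness if $(x\neq z)\to(x\neq y)\vee(y\neq z)$ and tight if $\neg(x\neq y)$ implies $x=y$. An operation is strongly extensional if inequality of outputs implies inequality of inputs, inputs in a product being unequal when some component is (disjunctively). An inequality on a group is translation invariant if $x\neq y$ implies $zx\neq zy$ and $xz\neq yz$ for all $z$. Antithesis translation. An affine ($\mathfrak L$-) predicate on a type is interpreted as a pair $P=(P^+,P^-)$ of intuitionistic predicates with $\neg(P^+\wedge P^-)$ (pointwise). Types and terms are unchanged. $P\vdash Q$ means both $P^+\vdash Q^+$ and $Q^-\vdash P^-$; $\vdash Q$ means $\top\vdash Q$, $\top=(\mathbf 1,\mathbf 0)$ (true, false). Connectives: $$P\boxtimes Q=(P^+\wedge Q^+,(P^+\to Q^-)\wedge(Q^+\to P^-)),\quad P\sqcap Q=(P^+\wedge Q^+,P^-\vee Q^-),\quad !P=(P^+,\neg P^+),\quad ?P=(\neg P^-,P^-).$$ $P$ is affirmative if $P\equiv\,!P$, refutative if $P\equiv\,?P$ ($\equiv$ is mutual entailment). An $\mathfrak L$-set is a type with an $\mathfrak L$-predicate $\circeq$ with $\vdash x\circeq x$, $x\circeq y\vdash y\circeq x$, $(x\circeq y)\boxtimes(y\circeq z)\vdash x\circeq z$; write $(x\circeq y)=((x=y),(x\neq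 y))$. An $\mathfrak L$-function $f:A\to B$ is an operation with $x_1\circeq x_2\vdash f(x_1)\circeq f(x_2)$. The cartesian product $A\times B$ has equality $(x_1\circeq x_2)\sqcap(y_1\circeq y_2)$; the tensor product $A\boxtimes B$ has the same underlying type with equality $(x_1\circeq x_2)\boxtimes(y_1\circeq y_2)$. An $\mathfrak L$-group is an $\mathfrak L$-set $G$ with an element $e$ and $\mathfrak L$-functions $m:G\boxtimes G\to G$ and $i:G\to G$ such that $\vdash m(x,e)\circeq x$, $\vdash m(e,x)\circeq x$, $\vdash m(x,i(x))\circeq e$, $\vdash m(i(x),x)\circeq e$, and $\vdash m(m(x,y),z)\circeq m(x,m(y,z))$. It is strong if $m$ is an $\mathfrak L$-function on $G\times G$. One writes $xy=m(x,y)$, $x^{-1}=i(x)$. An $\mathfrak L$-group has affirmative (refutative) equality if the predicate $\circeq$ is affirmative (refutative); with affirmative equality, $\neq$ is $\neg(x=y)$. *)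

(* Defs.v *)
From Stdlib Require Export RelationClasses Morphisms Setoid.

Set Implicit Arguments.

(** * The antithesis translation *)

Record LProp : Type := MkLProp {
  pos : Prop;
  neg : Prop;
  pos_neg_disjoint : ~ (pos /\ neg)
}.

Definition LEntails (P Q : LProp) : Prop :=
  (pos P -> pos Q) /\ (neg Q -> neg P).

Definition LEquiv (P Q : LProp) : Prop := LEntails P Q /\ LEntails Q P.

Program Definition LTop : LProp := {| pos := True; neg := False |}.
Next Obligation. tauto. Qed.

Definition LValid (P : LProp) : Prop := LEntails LTop P.

Program Definition LTensor (P Q : LProp) : LProp :=
  {| pos := pos P /\ pos Q;
     neg := (pos P -> neg Q) /\ (pos Q -> neg P) |}.
Next Obligation. pose proof (pos_neg_disjoint P). tauto. Qed.

Program Definition LMeet (P Q : LProp) : LProp :=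
  {| pos := pos P /\ pos Q; neg := neg P \/ neg Q |}.
Next Obligation.
  pose proof (pos_neg_disjoint P). pose proof (pos_neg_disjoint Q). tauto.
Qed.

Program Definition LBang (P : LProp) : LProp :=
  {| pos := pos P; neg := ~ pos P |}.
Next Obligation. tauto. Qed.

Program Definition LWhyNot (P : LProp) : LProp :=
  {| pos := ~ neg P; neg := neg P |}.
Next Obligation. tauto. Qed.

Definition Affirmative (P : LProp) : Prop := LEquiv P (LBang P).
Definition Refutative (P : LProp) : Prop := LEquiv P (LWhyNot P).

(** * Sets and groups on the affine side *)

(** A binary affine predicate; as an equality, [posR E x y] reads [x = y]
    and [negR E x y] reads [x <> y] (the inequality of the set). *)
Definition LRel (A : Type) : Type := A -> A -> LProp.
Definition posR {A : Type} (E : LRel A) (x y : A) : Prop := pos (E x y).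
Definition negR {A : Type} (E : LRel A) (x y : A) : Prop := neg (E x y).

Record IsLSet {A : Type} (E : LRel A) : Prop := {
  lset_refl : forall x, LValid (E x x);
  lset_sym : forall x y, LEntails (E x y) (E y x);
  lset_trans : forall x y z, LEntails (LTensor (E x y) (E y z)) (E x z)
}.

Definition IsLFun {A B : Type} (EA : LRel A) (EB : LRel B) (f : A -> B) : Prop :=
  forall x1 x2, LEntails (EA x1 x2) (EB (f x1) (f x2)).

Definition cartEq {A B : Type} (EA : LRel A) (EB : LRel B) : LRel (A * B) :=
  fun p q => LMeet (EA (fst p) (fst q)) (EB (snd p) (snd q)).

Definition tensorEq {A B : Type} (EA : LRel A) (EB : LRel B) : LRel (A * B) :=
  fun p q => LTensor (EA (fst p) (fst q)) (EB (snd p) (snd q)).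

Lemma cartEq_IsLSet {A B : Type} (EA : LRel A) (EB : LRel B) :
  IsLSet EA -> IsLSet EB -> IsLSet (cartEq EA EB).
Proof.
  intros [ra sa ta] [rb sb tb]; split.
  - intros [x u]; specialize (ra x); specialize (rb u).
    unfold LValid, LEntails in *; simpl in *; tauto.
  - intros [x u] [y v]; specialize (sa x y); specialize (sb u v).
    unfold LEntails in *; simpl in *; tauto.
  - intros [x u] [y v] [z w]; specialize (ta x y z); specialize (tb u v w).
    unfold LEntails in *; simpl in *; tauto.
Qed.

Lemma tensorEq_IsLSet {A B : Type} (EA : LRel A) (EB : LRel B) :
  IsLSet EA -> IsLSet EB -> IsLSet (tensorEq EA EB).
Proof.
  intros [ra sa ta] [rb sb tb]; split.
  - intros [x u]; specialize (ra x); specialize (rb u).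
    unfold LValid, LEntails in *; simpl in *; tauto.
  - intros [x u] [y v]; specialize (sa x y); specialize (sb u v).
    unfold LEntails in *; simpl in *; tauto.
  - intros [x u] [y v] [z w]; specialize (ta x y z); specialize (tb u v w).
    unfold LEntails in *; simpl in *; tauto.
Qed.

Definition uncurried {A B C : Type} (m : A -> B -> C) (p : A * B) : C :=
  m (fst p) (snd p).

Record IsLGroup {G : Type} (E : LRel G) (e : G) (m : G -> G -> G) (i : G -> G)
  : Prop := {
  lgroup_set : IsLSet E;
  lgroup_mul_fun : IsLFun (tensorEq E E) E (uncurried m);
  lgroup_inv_fun : IsLFun E E i;
  lgroup_mul_e : forall x, LValid (E (m x e) x);
  lgroup_e_mul : forall x, LValid (E (m e x) x);
  lgroup_mul_inv : forall x, LValid (E (m x (i x)) e);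
  lgroup_inv_mul : forall x, LValid (E (m (i x) x) e);
  lgroup_assoc : forall x y z, LValid (E (m (m x y) z) (m x (m y z)))
}.

Definition IsStrongLGroup {G : Type} (E : LRel G) (e : G) (m : G -> G -> G)
  (i : G -> G) : Prop :=
  IsLGroup E e m i /\ IsLFun (cartEq E E) E (uncurried m).

Definition AffirmativeEq {A : Type} (E : LRel A) : Prop :=
  forall x y, Affirmative (E x y).
Definition RefutativeEq {A : Type} (E : LRel A) : Prop :=
  forall x y, Refutative (E x y).

(** * Sets and groups on the intuitionistic side *)

Record IsIGroup {G : Type} (eq : relation G) (e : G) (m : G -> G -> G)
  (i : G -> G) : Prop := {
  igroup_equiv : Equivalence eq;
  igroup_mul_proper : Proper (eq ==> eq ==> eq) m;
  igroup_inv_proper : Proper (eq ==> eq) i;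
  igroup_mul_e : forall x, eq (m x e) x;
  igroup_e_mul : forall x, eq (m e x) x;
  igroup_mul_inv : forall x, eq (m x (i x)) e;
  igroup_inv_mul : forall x, eq (m (i x) x) e;
  igroup_assoc : forall x y z, eq (m (m x y) z) (m x (m y z))
}.

Record IsInequality {A : Type} (eq neq : relation A) : Prop := {
  ineq_proper : Proper (eq ==> eq ==> iff) neq;
  ineq_irrefl : Irreflexive neq;
  ineq_sym : Symmetric neq
}.

Record IsApartness {A : Type} (eq neq : relation A) : Prop := {
  apart_ineq : IsInequality eq neq;
  apart_cotrans : forall x y z, neq x z -> neq x y \/ neq y z
}.

Definition IsTight {A : Type} (eq neq : relation A) : Prop :=
  forall x y, ~ neq x y -> eq x y.

Definition StronglyExtensional {A B : Type} (neqA : relation A)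
  (neqB : relation B) (f : A -> B) : Prop :=
  forall x y, neqB (f x) (f y) -> neqA x y.

Definition prodNeq {A B : Type} (neqA : relation A) (neqB : relation B) :
  relation (A * B) :=
  fun p q => neqA (fst p) (fst q) \/ neqB (snd p) (snd q).

Definition TranslationInvariant {G : Type} (m : G -> G -> G)
  (neq : relation G) : Prop :=
  forall x y, neq x y -> forall z, neq (m z x) (m z y) /\ neq (m x z) (m y z).

(* Main.v *)
Require Import Defs.

Set Implicit Arguments.

(** An affine entailment is a pair of intuitionistic entailments, one between
    the affirmations and one, contravariant, between the refutations.  So each
    clause in the definition of an affine group splits into a statement about
    [=] and a statement about [<>].  The statements about [=] make up an
    intuitionistic group.  Among those about [<>], the one coming from
    transitivity says that [<>] respects [=] ([lset_iff]), and the one coming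
    from multiplication is a pair of cancellation laws: the refutation of a
    tensor is a pair of implications, each of which lets one coordinate be held
    fixed ([lfun_tensor_iff]).  On the cartesian product the refutation is a
    disjunction instead, and one gets strong extensionality ([lfun_cart_iff]).
    The unit, inverse and associativity axioms assert validity, which is a
    statement about [=] alone ([lvalid_iff]).  Together these give the basic
    description [lgroup_iff].

    The rest is group theory with a cancellable inequality.  Cancelling a factor
    is the same as multiplying by its inverse, so cancellation is translation
    invariance; the law for inverses is then automatic, because multiplying
    [x^-1 <> y^-1] by [x] on the left and by [y] on the right gives [y <> x]
    ([cancel_iff_translation]).  Strong extensionality of multiplication is
    equivalent to cotransitivity ([strongly_ext_iff_apartness]): from
    [x <> z] one compares the products [(x y^-1) y] and [(y y^-1) z], and
    conversely from [xu <> yv] one inserts [xv] between the two sides.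
    Affirmative and refutative equality then specialize these laws: in the first
    case they are contrapositives of congruence, and in the second the condition
    is exactly tightness. *)

(** * Affine predicates, sets and functions by components *)

(** Validity constrains only the affirmation: once [P] is affirmed,
    disjointness already excludes its refutation. *)
Lemma lvalid_iff (P : LProp) : LValid P <-> pos P.
Proof.
  pose proof (pos_neg_disjoint P).
  unfold LValid, LEntails; simpl; tauto.
Qed.

Lemma affirmative_iff (P : LProp) : Affirmative P <-> (neg P <-> ~ pos P).
Proof. unfold Affirmative, LEquiv, LEntails; simpl; tauto. Qed.

Lemma refutative_iff (P : LProp) : Refutative P <-> (~ neg P -> pos P).
Proof.
  pose proof (pos_neg_disjoint P).
  unfold Refutative, LEquiv, LEntails; simpl; tauto.
Qed.

Lemma inequality_not_eq {A : Type} (eq neq : relation A) :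
  Equivalence eq -> IsInequality eq neq -> forall x y, ~ (eq x y /\ neq x y).
Proof.
  intros Q [P I S] x y [Exy Nxy].
  rewrite Exy in Nxy; exact (I y Nxy).
Qed.

Definition lrel_of {A : Type} (eq neq : relation A)
  (disj : forall x y, ~ (eq x y /\ neq x y)) : LRel A :=
  fun x y => MkLProp (disj x y).

(** The refutation half of transitivity reads: if [x <> z] then [x = y] gives
    [y <> z] and [y = z] gives [x <> y].  These are the two one-sided forms of
    the statement that [<>] respects [=], and irreflexivity is the disjointness
    of the two components. *)
Lemma lset_iff {A : Type} (E : LRel A) :
  IsLSet E <-> Equivalence (posR E) /\ IsInequality (posR E) (negR E).
Proof.
  split.
  - intros [r s t].
    assert (R : forall x, posR E x x) by (intro x; exact (proj1 (lvalid_iff _) (r x))).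
    assert (S : forall x y, posR E x y -> posR E y x) by (intros x y; apply s).
    assert (NS : forall x y, negR E x y -> negR E y x) by (intros x y; apply s).
    assert (T : forall x y z, posR E x y -> posR E y z -> posR E x z)
      by (intros x y z Hxy Hyz; apply (t x y z); split; assumption).
    assert (NT : forall x y z, posR E x y -> negR E x z -> negR E y z)
      by (intros x y z Hxy Hxz; apply (t x y z); assumption).
    split; [split; [exact R | exact S | exact T] | split].
    + assert (P : forall x x' y y', posR E x x' -> posR E y y' ->
        negR E x y -> negR E x' y') by eauto.
      intros x x' Hx y y' Hy; split; eauto.
    + intros x Nx; exact (pos_neg_disjoint (E x x) (conj (R x) Nx)).
    + exact NS.
  - intros [Q [P I S]]; split.
    + intro x; apply <- lvalid_iff; change (posR E x x); reflexivity.
    + intros x y; split; [apply Q | apply S].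
    + intros x y z; split.
      * intros [Hxy Hyz]; change (posR E x z); transitivity y; assumption.
      * intro Nxz; change (negR E x z) in Nxz; split; intro H.
        -- change (posR E x y) in H; change (negR E y z).
           rewrite <- H; exact Nxz.
        -- change (posR E y z) in H; change (negR E x y).
           rewrite H; exact Nxz.
Qed.

(** Respecting the tensor equality in two variables amounts to respecting it in
    each variable separately.  For [<>], the laws with a shared argument follow
    by taking one of the two equalities to be reflexivity; conversely, an
    equality in one coordinate makes the two values share that argument. *)
Lemma lfun_tensor_iff {A B C : Type} (EA : LRel A) (EB : LRel B) (EC : LRel C)
  (f : A -> B -> C) :
  IsLSet EA -> IsLSet EB -> IsLSet EC ->
  IsLFun (tensorEq EA EB) EC (uncurried f) <->
  (Proper (posR EA ==> posR EB ==> posR EC) f /\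
   (forall x u v, negR EC (f x u) (f x v) -> negR EB u v) /\
   (forall x y u, negR EC (f x u) (f y u) -> negR EA x y)).
Proof.
  intros HA HB HC.
  apply lset_iff in HA, HB, HC.
  destruct HA as [QA _], HB as [QB _], HC as [QC [NC _ _]].
  split.
  - intro F; split; [| split].
    + intros x y Hxy u v Huv; apply (F (x, u) (y, v)); split; assumption.
    + intros x u v N; apply (F (x, u) (x, v)); [exact N | apply QA].
    + intros x y u N; apply (F (x, u) (y, u)); [exact N | apply QB].
  - intros [P [L R]] [x u] [y v]; split.
    + intros [Hxy Huv]; exact (P x y Hxy u v Huv).
    + intro N; change (negR EC (f x u) (f y v)) in N; split; intro H.
      * change (posR EA x y) in H; apply (L y).
        rewrite H in N; exact N.
      * change (posR EB u v) in H; apply (R x y v).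
        rewrite H in N; exact N.
Qed.

Lemma lfun_cart_iff {A B C : Type} (EA : LRel A) (EB : LRel B) (EC : LRel C)
  (f : A -> B -> C) :
  IsLFun (cartEq EA EB) EC (uncurried f) <->
  (Proper (posR EA ==> posR EB ==> posR EC) f /\
   StronglyExtensional (prodNeq (negR EA) (negR EB)) (negR EC) (uncurried f)).
Proof.
  split.
  - intro F; split.
    + intros x y Hxy u v Huv; apply (F (x, u) (y, v)); split; assumption.
    + intros p q; apply F.
  - intros [P S] [x u] [y v]; split.
    + intros [Hxy Huv]; exact (P x y Hxy u v Huv).
    + apply (S (x, u) (y, v)).
Qed.

Lemma lfun_iff {A B : Type} (EA : LRel A) (EB : LRel B) (f : A -> B) :
  IsLFun EA EB f <->
  (Proper (posR EA ==> posR EB) f /\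
   StronglyExtensional (negR EA) (negR EB) f).
Proof.
  split.
  - intro F; split; intros x y; apply F.
  - intros [P S] x y; split; [apply P | apply S].
Qed.

Lemma strongly_ext_uncurried_iff {A B C : Type} (nA : relation A)
  (nB : relation B) (nC : relation C) (f : A -> B -> C) :
  StronglyExtensional (prodNeq nA nB) nC (uncurried f) <->
  (forall x y u v, nC (f x u) (f y v) -> nA x y \/ nB u v).
Proof.
  split.
  - intros S x y u v; apply (S (x, u) (y, v)).
  - intros S [x u] [y v]; apply S.
Qed.

Lemma strongly_ext_cancel {A B C : Type} (nA : relation A) (nB : relation B)
  (nC : relation C) (f : A -> B -> C) :
  Irreflexive nA -> Irreflexive nB ->
  StronglyExtensional (prodNeq nA nB) nC (uncurried f) ->
  (forall x u v, nC (f x u) (f x v) -> nB u v) /\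
  (forall x y u, nC (f x u) (f y u) -> nA x y).
Proof.
  intros IA IB S; rewrite strongly_ext_uncurried_iff in S; split.
  - intros x u v N; destruct (S x x u v N) as [H | H];
      [destruct (IA x H) | exact H].
  - intros x y u N; destruct (S x y u u N) as [H | H];
      [exact H | destruct (IB u H)].
Qed.

(** The two cancellation laws are the refutation half of multiplication being
    affine on the tensor square, and the law for inverses is the refutation half
    of inversion being affine. *)
Lemma lgroup_iff {G : Type} (E : LRel G) (e : G) (m : G -> G -> G)
  (i : G -> G) :
  IsLGroup E e m i <->
  (IsIGroup (posR E) e m i /\ IsInequality (posR E) (negR E) /\
   (forall x y, negR E (i x) (i y) -> negR E x y) /\
   (forall x u v, negR E (m x u) (m x v) -> negR E u v) /\
   (forall x y u, negR E (m x u) (m y u) -> negR E x y)).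
Proof.
  split.
  - intros [HS HM HI me em mi im as_].
    pose proof (proj1 (lset_iff E) HS) as [Q N].
    apply (lfun_tensor_iff m HS HS HS) in HM; destruct HM as [PM [L R]].
    apply lfun_iff in HI; destruct HI as [PI SI].
    split; [split; try assumption; intros; apply -> lvalid_iff; auto |].
    split; [exact N |]; split; [exact SI |]; split; assumption.
  - intros [[Q PM PI me em mi im as_] [N [SI [L R]]]].
    assert (HS : IsLSet E) by (apply lset_iff; split; assumption).
    split; [exact HS | | | intros; apply <- lvalid_iff ..].
    + apply (lfun_tensor_iff m HS HS HS); auto.
    + apply lfun_iff; split; assumption.
    + apply me.
    + apply em.
    + apply mi.
    + apply im.
    + apply as_.
Qed.

(** * Groups with an inequality *)

Section GroupWithInequality.

Context {G : Type} (eq neq : relation G) (e : G) (m : G -> G -> G)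
  (i : G -> G).
Hypothesis group : IsIGroup eq e m i.
Hypothesis ineq : IsInequality eq neq.

Local Instance eq_equivalence : Equivalence eq := igroup_equiv group.
Local Instance mul_proper : Proper (eq ==> eq ==> eq) m :=
  igroup_mul_proper group.
Local Instance neq_proper : Proper (eq ==> eq ==> iff) neq := ineq_proper ineq.

Lemma mul_inv_cancel_l x y : eq (m (i x) (m x y)) y.
Proof.
  rewrite <- (igroup_assoc group), (igroup_inv_mul group).
  apply (igroup_e_mul group).
Qed.

Lemma mul_cancel_inv_l x y : eq (m x (m (i x) y)) y.
Proof.
  rewrite <- (igroup_assoc group), (igroup_mul_inv group).
  apply (igroup_e_mul group).
Qed.

Lemma mul_inv_cancel_r x y : eq (m (m x y) (i y)) x.
Proof.
  rewrite (igroup_assoc group), (igroup_mul_inv group).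
  apply (igroup_mul_e group).
Qed.

Lemma mul_cancel_inv_r x y : eq (m (m x (i y)) y) x.
Proof.
  rewrite (igroup_assoc group), (igroup_inv_mul group).
  apply (igroup_mul_e group).
Qed.

(** Translation by [z] and translation by [z^-1] undo each other, so preserving
    [<>] under all translations is the same as reflecting it.  Inversion is
    a composite of translations up to swapping the two sides:
    [x (x^-1) y = y] and [x (y^-1) y = x]. *)
Lemma cancel_iff_translation :
  ((forall x y, neq (i x) (i y) -> neq x y) /\
   (forall x u v, neq (m x u) (m x v) -> neq u v) /\
   (forall x y u, neq (m x u) (m y u) -> neq x y)) <->
  TranslationInvariant m neq.
Proof.
  split.
  - intros [_ [L R]] x y N z; split.
    + apply (L (i z)); rewrite !mul_inv_cancel_l; exact N.
    + apply (R _ _ (i z)); rewrite !mul_inv_cancel_r; exact N.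
  - intro T; split; [| split].
    + intros x y N.
      apply (fun H => proj1 (T _ _ H x)) in N.
      apply (fun H => proj2 (T _ _ H y)) in N.
      rewrite mul_cancel_inv_r, (igroup_assoc group), mul_cancel_inv_l in N.
      apply (ineq_sym ineq); exact N.
    + intros x u v N.
      apply (fun H => proj1 (T _ _ H (i x))) in N.
      rewrite !mul_inv_cancel_l in N; exact N.
    + intros x y u N.
      apply (fun H => proj2 (T _ _ H (i u))) in N.
      rewrite !mul_inv_cancel_r in N; exact N.
Qed.

Lemma strongly_ext_iff_apartness :
  (forall x u v, neq (m x u) (m x v) -> neq u v) ->
  (forall x y u, neq (m x u) (m y u) -> neq x y) ->
  (forall x y u v, neq (m x u) (m y v) -> neq x y \/ neq u v) <->
  IsApartness eq neq.
Proof.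
  intros L R; split.
  - intro S; split; [exact ineq |].
    intros x y z N.
    (* [x = (x y^-1) y] and [z = (y y^-1) z] *)
    assert (N' : neq (m (m x (i y)) y) (m (m y (i y)) z)).
    { rewrite mul_cancel_inv_r, (igroup_mul_inv group), (igroup_e_mul group).
      exact N. }
    destruct (S _ _ _ _ N') as [H | H].
    + left; exact (R _ _ _ H).
    + right; exact H.
  - intros [_ cotrans] x y u v N.
    destruct (cotrans _ (m x v) _ N) as [H | H].
    + right; exact (L _ _ _ H).
    + left; exact (R _ _ _ H).
Qed.

End GroupWithInequality.

Lemma denial_inequality {A : Type} (eq neq : relation A) :
  Equivalence eq -> (forall x y, neq x y <-> ~ eq x y) -> IsInequality eq neq.
Proof.
  intros Q D; split.
  - intros x x' Hx y y' Hy; rewrite !D, Hx, Hy; reflexivity.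
  - intros x N; apply (D x x); [exact N | reflexivity].
  - intros x y N; apply D; intro H; apply (D x y); [exact N |].
    symmetry; exact H.
Qed.

(** * The kinds of affine groups *)

Lemma strong_lgroup_iff {G : Type} (E : LRel G) (e : G) (m : G -> G -> G)
  (i : G -> G) :
  IsLGroup E e m i ->
  IsStrongLGroup E e m i <->
  (forall x y u v, negR E (m x u) (m y v) -> negR E x y \/ negR E u v).
Proof.
  intro H; unfold IsStrongLGroup.
  rewrite lfun_cart_iff, strongly_ext_uncurried_iff.
  pose proof (igroup_mul_proper (proj1 (proj1 (lgroup_iff E e m i) H))).
  tauto.
Qed.

(** When [<>] is the negation of [=], the laws for [<>] are contrapositives of
    the fact that the operations respect [=]. *)
Lemma affirmative_lgroup_iff {G : Type} (E : LRel G) (e : G) (m : G -> G -> G)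
  (i : G -> G) :
  (IsLGroup E e m i /\ AffirmativeEq E) <->
  (IsIGroup (posR E) e m i /\ (forall x y, negR E x y <-> ~ posR E x y)).
Proof.
  rewrite lgroup_iff; split.
  - intros [[Gr _] AE]; split; [exact Gr |].
    intros x y; exact (proj1 (affirmative_iff _) (AE x y)).
  - intros [Gr D]; split.
    + pose proof (igroup_equiv Gr) as Q.
      pose proof (igroup_mul_proper Gr) as PM.
      pose proof (igroup_inv_proper Gr) as PI.
      split; [exact Gr |].
      split; [exact (denial_inequality _ Q D) |].
      setoid_rewrite D.
      repeat split; intros * N H; apply N; rewrite H; reflexivity.
    + intros x y; exact (proj2 (affirmative_iff _) (D x y)).
Qed.

(** Refutativity is tightness.  Strong extensionality of multiplication gives
    the cancellation laws because [<>] is irreflexive: of the two alternatives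
    it offers, the shared argument rules one out. *)
Lemma refutative_strong_lgroup_iff {G : Type} (E : LRel G) (e : G)
  (m : G -> G -> G) (i : G -> G) :
  (IsStrongLGroup E e m i /\ RefutativeEq E) <->
  (IsIGroup (posR E) e m i /\
   IsApartness (posR E) (negR E) /\ IsTight (posR E) (negR E) /\
   StronglyExtensional (prodNeq (negR E) (negR E)) (negR E) (uncurried m) /\
   StronglyExtensional (negR E) (negR E) i).
Proof.
  assert (T : RefutativeEq E <-> IsTight (posR E) (negR E)).
  { split; intros H x y.
    - exact (proj1 (refutative_iff _) (H x y)).
    - exact (proj2 (refutative_iff _) (H x y)). }
  rewrite T, strongly_ext_uncurried_iff; split.
  - intros [HS Ti].
    pose proof (proj1 HS) as HG.
    pose proof (proj1 (strong_lgroup_iff HG) HS) as SM.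
    apply lgroup_iff in HG; destruct HG as [Gr [N [SI [L R]]]].
    pose proof (proj1 (strongly_ext_iff_apartness Gr N L R) SM) as Ap.
    exact (conj Gr (conj Ap (conj Ti (conj SM SI)))).
  - intros [Gr [Ap [Ti [SM SI]]]]; split; [| exact Ti].
    pose proof (apart_ineq Ap) as N.
    pose proof (ineq_irrefl N) as I.
    pose proof (proj2 (strongly_ext_uncurried_iff _ _ _ m) SM) as SM'.
    assert (HG : IsLGroup E e m i).
    { apply lgroup_iff; split; [exact Gr |]; split; [exact N |].
      split; [exact SI | exact (strongly_ext_cancel I I SM')]. }
    exact (proj2 (strong_lgroup_iff HG) SM).
Qed.

Theorem theorem7p2 (G : Type) (e : G) (m : G -> G -> G) (i : G -> G) :
  (* every intuitionistic equality with an inequality is (the pair of components of)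
     an affine relation, so the characterizations below cover all such structures *)
  (forall eq neq : G -> G -> Prop,
      Equivalence eq -> IsInequality eq neq ->
      exists E : LRel G, forall x y, posR E x y = eq x y /\ negR E x y = neq x y)
  /\
  (forall E : LRel G,
      IsLGroup E e m i <->
      (IsIGroup (posR E) e m i /\ IsInequality (posR E) (negR E) /\
       (forall x y, negR E (i x) (i y) -> negR E x y) /\
       (forall x u v, negR E (m x u) (m x v) -> negR E u v) /\
       (forall x y u, negR E (m x u) (m y u) -> negR E x y)))
  /\
  (forall E : LRel G,
      IsLGroup E e m i ->
      (IsStrongLGroup E e m i <->
       (forall x y u v, negR E (m x u) (m y v) -> negR E x y \/ negR E u v)) /\
      ((forall x y u v, negR E (m x u) (m y v) -> negR E x y \/ negR E u v) <->
       IsApartness (posR E) (negR E)))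
  /\
  ((forall E : LRel G,
      (IsLGroup E e m i /\ AffirmativeEq E) <->
      (IsIGroup (posR E) e m i /\ (forall x y, negR E x y <-> ~ posR E x y))) /\
   (forall eq : G -> G -> Prop,
      IsIGroup eq e m i ->
      exists E : LRel G,
        (forall x y, posR E x y = eq x y) /\ IsLGroup E e m i /\ AffirmativeEq E))
  /\
  (forall E : LRel G,
      (IsStrongLGroup E e m i /\ RefutativeEq E) <->
      (IsIGroup (posR E) e m i /\
       IsApartness (posR E) (negR E) /\ IsTight (posR E) (negR E) /\
       StronglyExtensional (prodNeq (negR E) (negR E)) (negR E) (uncurried m) /\
       StronglyExtensional (negR E) (negR E) i))
  /\
  (forall E : LRel G,
      IsLGroup E e m i <->
      (IsIGroup (posR E) e m i /\ IsInequality (posR E) (negR E) /\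
       TranslationInvariant m (negR E))).
Proof.
  repeat match goal with |- _ /\ _ => split end.
  - intros eq neq Q N.
    exists (lrel_of eq neq (inequality_not_eq Q N)); split; reflexivity.
  - intro E; apply lgroup_iff.
  - intros E HG; split; [exact (strong_lgroup_iff HG) |].
    apply lgroup_iff in HG; destruct HG as [Gr [N [_ [L R]]]].
    exact (strongly_ext_iff_apartness Gr N L R).
  - intro E; apply affirmative_lgroup_iff.
  - intros eq Gr.
    assert (D : forall x y, ~ (eq x y /\ ~ eq x y)) by (intros; tauto).
    exists (lrel_of eq (fun x y => ~ eq x y) D).
    split; [reflexivity |].
    apply affirmative_lgroup_iff; split; [exact Gr | reflexivity].
  - intro E; apply refutative_strong_lgroup_iff.
  - intro E; rewrite lgroup_iff; split.
    + intros [Gr [N C]]; split; [exact Gr |]; split; [exact N |].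
      exact (proj1 (cancel_iff_translation Gr N) C).
    + intros [Gr [N T]]; split; [exact Gr |]; split; [exact N |].
      exact (proj2 (cancel_iff_translation Gr N) T).
Qed.
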